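(* Let $a,b,c,d$ be non-zero real numbers and let $(x_n)_{n\ge -2}$, $(y_n)_{n\ge -2}$ be a well-defined real solution, with initial values $x_{-2},x_{-1},x_0,y_{-2},y_{-1},y_0$, of the system $$x_{n+1}=\frac{x_{n-2}y_{n-1}}{y_{n}(a+bx_{n-2}y_{n-1})},\qquad y_{n+1}=\frac{y_{n-2}x_{n-1}}{x_{n}(c+dy_{n-2}x_{n-1})},\qquad n\ge 0.$$ If $x_0=-x_{-2}$, $y_0=-y_{-2}$, $a=c$, $b=-d$ and $x_{-1}y_{-2}=-x_{-2}y_{-1}=\dfrac{1+a}{b}$, then the solution is periodic with period four.
   Context: A solution is well-defined if no denominator appearing in the recurrence vanishes for any $n\ge 0$. A solution is periodic with period $p$ if $x_{n+p}=x_n$ and $y_{n+p}=y_n$ for all $n\ge -2$. *)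

(* Defs.v *)
From Stdlib Require Import Reals ZArith.
Open Scope R_scope.

(* Sequences indexed by the integers n >= -2 are functions Z -> R of which only
   the values at indices n >= -2 are ever constrained or used. *)

Definition denom_x (a b : R) (x y : Z -> R) (n : Z) : R :=
  y n * (a + b * x (n - 2)%Z * y (n - 1)%Z).

Definition denom_y (c d : R) (x y : Z -> R) (n : Z) : R :=
  x n * (c + d * y (n - 2)%Z * x (n - 1)%Z).

Definition solution (a b c d : R) (x y : Z -> R) : Prop :=
  forall n : Z, (0 <= n)%Z ->
    x (n + 1)%Z = x (n - 2)%Z * y (n - 1)%Z / denom_x a b x y n /\
    y (n + 1)%Z = y (n - 2)%Z * x (n - 1)%Z / denom_y c d x y n.

(* Division on R is total, so the non-vanishing of the denominators has to be
   required separately from the recurrence. *)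
Definition well_defined (a b c d : R) (x y : Z -> R) : Prop :=
  forall n : Z, (0 <= n)%Z ->
    denom_x a b x y n <> 0 /\ denom_y c d x y n <> 0.

Definition periodic (p : Z) (x y : Z -> R) : Prop :=
  forall n : Z, (-2 <= n)%Z -> x (n + p)%Z = x n /\ y (n + p)%Z = y n.

(* Main.v *)
Require Import Defs.
From Stdlib Require Import Reals ZArith Lia Lra.
Open Scope R_scope.

(** The constant [k = (1 + a) / b] is chosen so that [a + b * (- k) = -1] and,
    since [c = a] and [d = - b], also [c + d * k = -1].  Hence as long as
    [x (n - 2) * y (n - 1) = - k] and [y (n - 2) * x (n - 1) = k], the system
    collapses to [x (n + 1) = k / y n] and [y (n + 1) = - k / x n].  If in
    addition [x n = - x (n - 2)] and [y n = - y (n - 2)], then these quotients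
    are [- x (n - 1)] and [- y (n - 1)], and both product conditions hold again
    one index later.  So the four conditions together form an invariant of the
    system ([locked_step]), and the hypotheses on the initial values say
    precisely that it holds at [n = 0].  Both sequences therefore change sign
    under a shift by two, and applying this twice gives the period four. *)

(** The two sign relations are not preserved by themselves: it is the values of
    the products that turn the recurrence into [x (n + 1) = - x (n - 1)]. *)
Definition locked (k : R) (x y : Z -> R) (n : Z) : Prop :=
  (x n = - x (n - 2)%Z /\ y n = - y (n - 2)%Z) /\
  (x (n - 2)%Z * y (n - 1)%Z = - k /\ y (n - 2)%Z * x (n - 1)%Z = k).

(** One component of the system at one index, with [p], [q], [r] standing for
    [x (n - 2)], [y (n - 1)], [y n], and [z] for [x (n - 1)].  Both equations
    use it, the second with [b] and [k] negated. *)
Lemma next_value_opp (a b k p q r z : R) :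
  b * k = 1 + a -> p * q = - k -> r * z = - k -> r * (a + b * p * q) <> 0 ->
  p * q / (r * (a + b * p * q)) = - z.
Proof.
  intros Hk Hpq Hrz Hden.
  assert (Hfac : a + b * p * q = -1)
    by (rewrite Rmult_assoc, Hpq; lra).
  rewrite Hfac in *.
  assert (Hr : r <> 0) by (intro H; apply Hden; rewrite H; ring).
  rewrite Hpq, <- Hrz.
  field; exact Hr.
Qed.

Lemma locked_step (a b k : R) (x y : Z -> R) (n : Z) :
  b * k = 1 + a ->
  solution a b a (- b) x y -> well_defined a b a (- b) x y ->
  (0 <= n)%Z -> locked k x y n -> locked k x y (n + 1).
Proof.
  intros Hk Hsol Hwd Hn [[Hx Hy] [Hu Hv]].
  destruct (Hsol n Hn) as [Ex Ey].
  destruct (Hwd n Hn) as [Dx Dy].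
  unfold denom_x in Ex, Dx; unfold denom_y in Ey, Dy.
  rewrite (next_value_opp a b k _ _ _ (x (n - 1)%Z)) in Ex;
    [ | exact Hk | exact Hu | rewrite Hy; lra | exact Dx ].
  rewrite (next_value_opp a (- b) (- k) _ _ _ (y (n - 1)%Z)) in Ey;
    [ | lra | lra | rewrite Hx; lra | exact Dy ].
  unfold locked.
  replace (n + 1 - 2)%Z with (n - 1)%Z by lia.
  replace (n + 1 - 1)%Z with n by lia.
  repeat split.
  - exact Ex.
  - exact Ey.
  - rewrite Hy; lra.
  - rewrite Hx; lra.
Qed.

Lemma periodic_of_antiperiodic (x y : Z -> R) :
  (forall n : Z, (0 <= n)%Z ->
     x n = - x (n - 2)%Z /\ y n = - y (n - 2)%Z) ->
  periodic 4 x y.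
Proof.
  intros H n Hn.
  destruct (H (n + 4)%Z) as [Hx4 Hy4]; [lia | ].
  destruct (H (n + 2)%Z) as [Hx2 Hy2]; [lia | ].
  replace (n + 4 - 2)%Z with (n + 2)%Z in * by lia.
  replace (n + 2 - 2)%Z with n in * by lia.
  split; lra.
Qed.

Theorem theorem4p2 (a b c d : R) (x y : Z -> R)
  (ha : a <> 0) (hb : b <> 0) (hc : c <> 0) (hd : d <> 0)
  (hsol : solution a b c d x y)
  (hwd : well_defined a b c d x y)
  (hx0 : x 0%Z = - x (-2)%Z)
  (hy0 : y 0%Z = - y (-2)%Z)
  (hac : a = c)
  (hbd : b = - d)
  (hinit : x (-1)%Z * y (-2)%Z = - (x (-2)%Z * y (-1)%Z))
  (hinit' : - (x (-2)%Z * y (-1)%Z) = (1 + a) / b) :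
  periodic 4 x y.
Proof.
  assert (Hd : d = - b) by lra.
  subst c d.
  set (k := (1 + a) / b) in *.
  assert (Hk : b * k = 1 + a) by (unfold k; field; exact hb).
  apply periodic_of_antiperiodic.
  intros n Hn.
  cut (locked k x y n); [intros [H _]; exact H | ].
  revert n Hn.
  apply natlike_ind.
  - unfold locked; simpl.
    repeat split; [exact hx0 | exact hy0 | lra | lra].
  - intros n Hn IH.
    exact (locked_step a b k x y n Hk hsol hwd Hn IH).
Qed.
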